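(* Let $\mathcal{H}$ be a hypergraph, $e\in E(\mathcal{H})$ an edge, and $e=e'\cup e''$ a division of $e$ (with $e',e''$ nonempty and disjoint). Then $$|\mathcal{E}(\mathcal{H})-\mathcal{E}(\mathcal{H}\triangleleft e)|\le 2\sqrt{|e'||e''|}.$$
   Context: A hypergraph $\mathcal{H}=(V,E)$ consists of a finite vertex set $V$ and a set $E$ of edges, each a subset of $V$ of cardinality at least $2$ (distinct edges distinct). A multi-hypergraph is a pair $(V,E)$ with $E$ a multiset of subsets of $V$ (of any cardinality). For a (multi-)hypergraph and $i\neq j$, $d(\{i,j\})$ is the number of edges (with multiplicity) containing both $i$ and $j$; the adjacency matrix has zero diagonal and $(i,j)$ entry $d(\{i,j\})$, and the energy $\mathcal{E}$ is the sum of absolute values of its eigenvalues. For an edge $e=e'\cup e''$ with $e',e''$ nonempty and disjoint, $\mathcal{H}\triangleleft e$ is the multi-hypergraph with vertex set $V$ and edge multiset obtained from $E$ by removing $e$ and adding $e'$ and $e''$. *)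

(* Defs.v *)
From mathcomp Require Import all_boot all_order all_algebra.
From mathcomp Require Import finmap multiset.

Set Implicit Arguments.
Unset Strict Implicit.
Unset Printing Implicit Defensive.

Import Order.TTheory GRing.Theory Num.Theory.
Local Open Scope ring_scope.

Record hypergraph (V : finType) := Hypergraph {
  edges : {set {set V}};
  edges_card : forall e, e \in edges -> (2 <= #|e|)%N
}.

(* The value [M e] of the multiset [M] at [e] is the multiplicity of [e]. *)
Definition multi_hypergraph (V : finType) := {mset {set V}}%mset.

Definition multi_of_hypergraph (V : finType) (H : hypergraph V) :
  multi_hypergraph V := seq_mset (enum (edges H)).

Coercion multi_of_hypergraph : hypergraph >-> multi_hypergraph.

Lemma multi_of_hypergraphE (V : finType) (H : hypergraph V) (e : {set V}) :
  multi_of_hypergraph H e = (e \in edges H).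
Proof. by rewrite mset_seqE count_uniq_mem ?enum_uniq // mem_enum. Qed.

Definition codegree (V : finType) (M : multi_hypergraph V) (i j : V) : nat :=
  (\sum_(e : {set V} | (i \in e) && (j \in e)) M e)%N.

Definition adjacency (C : numClosedFieldType) (V : finType)
    (M : multi_hypergraph V) : 'M[C]_#|V| :=
  \matrix_(i, j) if i == j then 0
                 else (codegree M (enum_val i) (enum_val j))%:R.

(* The roots of the characteristic polynomial, listed with multiplicity. *)
Definition eigenvalues (C : numClosedFieldType) (n : nat) (A : 'M[C]_n) :
  seq C := sval (closed_field_poly_normal (char_poly A)).

Lemma eigenvaluesP (C : numClosedFieldType) (n : nat) (A : 'M[C]_n) :
  char_poly A = \prod_(z <- eigenvalues A) ('X - z%:P).
Proof.
rewrite /eigenvalues; case: closed_field_poly_normal => r /= {1}->.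
by rewrite (monicP (char_poly_monic A)) scale1r.
Qed.

(* [C] plays the role of the complex numbers.  The adjacency matrix is real
   symmetric, so its eigenvalues are real and the norm [`|z|] below is the usual
   absolute value. *)
Definition energy (C : numClosedFieldType) (V : finType)
    (M : multi_hypergraph V) : C :=
  \sum_(z <- eigenvalues (adjacency C M)) `|z|.

Definition divide_edge (V : finType) (M : multi_hypergraph V)
    (e e1 e2 : {set V}) : multi_hypergraph V :=
  (e1 +` (e2 +` (M `\ e)))%mset.

(* Main.v *)
(** The adjacency matrices [A] of [H] and [B] of [H <| e] differ by
    [u^T v + v^T u], where [u] and [v] are the indicator rows of [e1] and [e2].
    If [A = S |A|] is the polar decomposition of [A], the energy of [A] is the
    trace of [A S^*].  Since [S] is a contraction, [|tr (B S^* )|] is at most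
    the energy of [B], while by Cauchy-Schwarz each rank-one term of [A - B]
    contributes at most [sqrt (|e1| |e2|)] to the trace of [(A - B) S^*].
    Exchanging [A] and [B] amounts to changing the sign of [u]. *)
Require Import Defs.
From mathcomp Require Import all_boot all_order all_algebra.
From mathcomp Require Import finmap multiset.
From mathcomp Require Import ring.

Set Implicit Arguments.
Unset Strict Implicit.
Unset Printing Implicit Defensive.

Import Order.TTheory GRing.Theory Num.Theory.
Local Open Scope ring_scope.
Local Open Scope sesquilinear_scope.

Local Notation "''[' u , v ]" := (dotmx u v) : ring_scope.
Local Notation "''[' u ]" := (dotmx u u) : ring_scope.

Lemma char_poly_conj (R : comUnitRingType) n (P A : 'M[R]_n) :
  P \in unitmx -> char_poly (invmx P *m A *m P) = char_poly A.
Proof.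
move=> Pu; rewrite /char_poly.
have -> : char_poly_mx (invmx P *m A *m P) =
    map_mx polyC (invmx P) *m char_poly_mx A *m map_mx polyC P.
  rewrite /char_poly_mx mulmxBr mulmxBl !map_mxM /=; congr (_ - _).
  by rewrite mul_mx_scalar -scalemxAl -map_mxM mulVmx // map_mx1 scalemx1.
rewrite !det_mulmx mulrAC -det_mulmx -map_mxM mulVmx //.
by rewrite map_mx1 det1 mul1r.
Qed.

Section TraceNorm.
Variable C : numClosedFieldType.

(** By the spectral theorem [A] is similar to its spectral diagonal, so both families factor the
    same characteristic polynomial and agree up to permutation. *)
Lemma sum_norm_eigenvalues n (A : 'M[C]_n) : A \is normalmx ->
  \sum_(z <- eigenvalues A) `|z| = \sum_i `|spectral_diag A 0 i|.
Proof.
move=> /orthomx_spectralP Aeq.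
have: char_poly A = \prod_i ('X - (spectral_diag A 0 i)%:P).
  rewrite {1}Aeq char_poly_conj ?spectral_unit //.
  rewrite char_poly_trig ?diag_mx_is_trig //.
  by apply: eq_bigr => i _; rewrite mxE eqxx.
rewrite eigenvaluesP -[RHS](big_map _ predT (fun z => 'X - z%:P)).
by move=> /prod_XsubC_eq/(perm_big _) ->; rewrite big_map.
Qed.

Lemma dotmx_mul_unitary n (u : 'rV[C]_n) (P : 'M_n) :
  P \is unitarymx -> '[u *m P] = '[u].
Proof. by move=> Pu; rewrite !dotmxE trmx_mul map_mxM mulmxA mulmxtVK. Qed.

Lemma dotmx_sum n (u : 'rV[C]_n) : '[u] = \sum_i `|u 0 i| ^+ 2.
Proof.
by rewrite dotmxE mxE; apply: eq_bigr => i _; rewrite !mxE normCK.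
Qed.

Lemma dotmx_ge0 n (u : 'rV[C]_n) : 0 <= '[u].
Proof. by rewrite dotmx_sum sumr_ge0 // => i _; rewrite exprn_ge0. Qed.

Lemma dotmx_mul_diag_le n (u d : 'rV[C]_n) :
  (forall i, `|d 0 i| <= 1) -> '[u *m diag_mx d] <= '[u].
Proof.
move=> d1; rewrite !dotmx_sum; apply: ler_sum => i _.
by rewrite mul_mx_diag mxE normrM exprMn ler_piMr ?exprn_ge0 // exprn_ile1.
Qed.

(* The adjoint of the unitary factor of the polar decomposition of a normal
   matrix; the junk value [x / 0 = 0] makes it vanish on the kernel. *)
Definition phase n (A : 'M[C]_n) : 'M[C]_n :=
  invmx (spectralmx A)
    *m diag_mx (map_mx (fun z => `|z| / z) (spectral_diag A)) *m spectralmx A.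

(** Unitary factors preserve length, and each diagonal entry has modulus 1, or 0 at a zero
    eigenvalue. *)
Lemma dotmx_mul_phase_le n (A : 'M[C]_n) (u : 'rV_n) :
  '[u *m phase A] <= '[u].
Proof.
have Pu := spectral_unitarymx A.
rewrite /phase !mulmxA dotmx_mul_unitary //.
apply: le_trans (dotmx_mul_diag_le _ _) _ => [i|].
  rewrite mxE normrM normfV normr_id.
  have [->|nz] := eqVneq `|spectral_diag A 0 i| 0.
    by rewrite mul0r ler01.
  by rewrite mulfV.
by rewrite dotmx_mul_unitary // invmx_unitary // trmxC_unitary.
Qed.

Lemma mxtrace_mul_phase n (A : 'M[C]_n) : A \is normalmx ->
  \tr (A *m phase A) = \sum_(z <- eigenvalues A) `|z|.
Proof.
move=> An; rewrite sum_norm_eigenvalues //.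
rewrite {1}(orthomx_spectralP An) /phase !mulmxA mulmxK ?spectral_unit //.
rewrite mxtrace_mulC !mulmxA mulmxV ?spectral_unit // mul1mx.
rewrite mulmx_diag mxtrace_diag; apply: eq_bigr => i _; rewrite !mxE.
have [->|nz] := eqVneq (spectral_diag A 0 i) 0.
  by rewrite normr0 !mul0r.
by rewrite mulrC divfK.
Qed.

Lemma norm_dotmx_contraction_le n (S : 'M[C]_n) (u v : 'rV_n) :
  (forall w : 'rV_n, '[w *m S] <= '[w]) ->
  `|'[u *m S, v]| <= sqrtC ('[u] * '[v]).
Proof.
move=> S1; have [+ _] := CauchySchwarz_sqrt (@dotmx C n) (u *m S) v.
move=> /le_trans; apply; rewrite sqrtCM ?nnegrE ?dotmx_ge0 //.
rewrite ler_wpM2r ?sqrtC_ge0 ?dotmx_ge0 //.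
by rewrite ler_sqrtC ?nnegrE ?dotmx_ge0 ?S1.
Qed.

(** In an orthonormal eigenbasis of [A], the trace is the sum of the eigenvalues weighted by the
    diagonal entries of [S]; Cauchy-Schwarz bounds these by 1 in modulus. *)
Lemma norm_mxtrace_contraction_le n (A S : 'M[C]_n) : A \is normalmx ->
  (forall w : 'rV_n, '[w *m S] <= '[w]) ->
  `|\tr (A *m S)| <= \sum_(z <- eigenvalues A) `|z|.
Proof.
move=> An S1; rewrite sum_norm_eigenvalues //.
have Pu := spectral_unitarymx A; set P := spectralmx A in Pu.
have -> : \tr (A *m S) =
    \sum_i spectral_diag A 0 i * '[row i P *m S, row i P].
  rewrite {1}(orthomx_spectralP An) -/P -!mulmxA mxtrace_mulC.
  rewrite invmx_unitary // -mulmxA mul_diag_mx.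
  apply: eq_bigr => i _; rewrite mxE; congr (_ * _).
  by rewrite dotmxE -row_mul !mxE; apply: eq_bigr => k _; rewrite !mxE.
apply: le_trans (ler_norm_sum _ _ _) _; apply: ler_sum => i _.
rewrite normrM ler_piMr //.
apply: le_trans (norm_dotmx_contraction_le _ _ S1) _.
by rewrite (row_unitarymxP Pu) eqxx mulr1 sqrtC1.
Qed.

Lemma sum_norm_eigenvaluesB_le n (A B : 'M[C]_n) (u v : 'rV_n) :
  A \is normalmx -> B \is normalmx ->
  A - B = u ^t* *m v + v ^t* *m u ->
  \sum_(z <- eigenvalues A) `|z| - \sum_(z <- eigenvalues B) `|z|
    <= 2 * sqrtC ('[u] * '[v]).
Proof.
move=> An Bn AB; have S1 := dotmx_mul_phase_le A.
have trE (x y : 'rV[C]_n) :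
    \tr (x ^t* *m y *m phase A) = '[y *m phase A, x].
  by rewrite -mulmxA mxtrace_mulC /mxtrace big_ord1 dotmxE.
rewrite lerBlDl -mxtrace_mul_phase // -[X in X *m _](subrK B) AB.
rewrite !mulmxDl !mxtraceD !trE.
(* This sum is the trace of [A *m phase A], hence nonnegative and equal to its own norm, so the
   triangle inequality applies although the separate traces may not be real. *)
rewrite -[X in X <= _]ger0_norm; last first.
  rewrite -!trE -!mxtraceD -!mulmxDl -AB subrK mxtrace_mul_phase //.
  by rewrite sumr_ge0.
rewrite addrC; apply: le_trans (ler_normD _ _) _.
rewrite lerD ?norm_mxtrace_contraction_le //.
apply: le_trans (ler_normD _ _) _; rewrite mulr_natl mulr2n.
rewrite {2}['[u] * '[v]]mulrC addrC.
by rewrite lerD ?norm_dotmx_contraction_le.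
Qed.

Lemma norm_sum_norm_eigenvaluesB_le n (A B : 'M[C]_n) (u v : 'rV_n) :
  A \is normalmx -> B \is normalmx ->
  A - B = u ^t* *m v + v ^t* *m u ->
  `|\sum_(z <- eigenvalues A) `|z| - \sum_(z <- eigenvalues B) `|z| |
    <= 2 * sqrtC ('[u] * '[v]).
Proof.
move=> An Bn AB; rewrite real_ler_norml; last first.
  by rewrite rpredB // ger0_real // sumr_ge0.
rewrite sum_norm_eigenvaluesB_le // andbT lerNl opprB.
have -> : '[u] * '[v] = '[- u] * '[v] by rewrite hnormN.
apply: sum_norm_eigenvaluesB_le => //.
have -> : (- u) ^t* = - u ^t* by apply/matrixP => i j; rewrite !mxE rmorphN.
by rewrite -opprB AB opprD mulmxN mulNmx.
Qed.

End TraceNorm.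

Lemma adjacency_normal (C : numClosedFieldType) (V : finType)
    (M : multi_hypergraph V) : adjacency C M \is normalmx.
Proof.
apply: symmetric_normalmx; last first.
  by apply/mxOverP => i j; rewrite mxE; case: ifP; rewrite ?real0 ?realn.
apply/is_hermitianmxP; rewrite expr0 scale1r; apply/matrixP => i j.
rewrite !mxE eq_sym; case: ifP => // _; congr _%:R.
by apply: eq_bigl => f; rewrite andbC.
Qed.

(** The term for [e] is added on the left because subtraction in [nat] truncates. Multiplicities are
    compared edge by edge: only [e] loses a copy, and [He] ensures that there is one to lose.
    Nothing prevents [e1] or [e2] from being already an edge. *)
Lemma codegree_divide_edge (V : finType) (H : hypergraph V)
    (e e1 e2 : {set V}) (i j : V) : e \in edges H ->
  (codegree (divide_edge H e e1 e2) i j + ((i \in e) && (j \in e)) =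
   codegree H i j + ((i \in e1) && (j \in e1)) + ((i \in e2) && (j \in e2)))%N.
Proof.
move=> He.
have one (f : {set V}) : (((i \in f) && (j \in f)) : nat) =
    (\sum_(g : {set V} | (i \in g) && (j \in g)) (g == f))%N.
  rewrite big_mkcond (bigD1 f) //= eqxx big1 ?addn0; last first.
    by move=> g /negPf ->; case: ifP.
  by case: ifP.
rewrite !one /codegree -!big_split /=; apply: eq_bigr => g _.
rewrite /divide_edge !(mset1DE, msetB1E) multi_of_hypergraphE.
have [->|_] := eqVneq g e; first by rewrite He; do 2!case: (e == _).
by case: (g \in _); do 2!case: (g == _).
Qed.

Theorem theorem13 (C : numClosedFieldType) (V : finType) (H : hypergraph V)
    (e e1 e2 : {set V}) (He : e \in edges H) (e_split : e = e1 :|: e2)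
    (e1_neq0 : e1 != set0) (e2_neq0 : e2 != set0)
    (e12_disj : [disjoint e1 & e2]) :
  `|energy C H - energy C (divide_edge H e e1 e2)|
    <= 2 * sqrtC (#|e1| * #|e2|)%:R.
Proof.
pose ind (f : {set V}) : 'rV[C]_#|V| := \row_i (enum_val i \in f)%:R.
have indE (f : {set V}) : '[ind f] = #|f|%:R.
  rewrite dotmx_sum (eq_bigr (fun i => (enum_val i \in f)%:R)); last first.
    move=> i _; rewrite mxE.
    by case: (_ \in _); rewrite ?normr1 ?normr0 ?expr1n ?expr0n.
  rewrite -(big_enum_val (fun x => (x \in f)%:R)) -natr_sum -sum1_card.
  by congr _%:R; rewrite [RHS]big_mkcond; apply: eq_bigr => x _; case: (_ \in _).
rewrite natrM -!indE.
apply: norm_sum_norm_eigenvaluesB_le; rewrite ?adjacency_normal //.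
apply/matrixP => i j; rewrite !mxE !big_ord1 !mxE !conjC_nat.
have disj x : ~~ ((x \in e1) && (x \in e2)).
  by apply/negP => /andP[x1 x2]; have := disjointFr e12_disj x1; rewrite x2.
(* On the diagonal both adjacency matrices vanish, and so does the rank-two term, since no vertex
   lies in both parts. *)
case: eqVneq => [<-|_].
  have := disj (enum_val i); do 2!case: (_ \in _) => //=; move=> _;
    by rewrite ?mulr0 ?mul0r subrr addr0.
have := codegree_divide_edge e1 e2 (enum_val i) (enum_val j) He.
move=> /(congr1 (fun n => n%:R : C)); rewrite !natrD e_split !inE.
move=> /(canRL (addrK _)) ->.
(* Off the diagonal, a pair inside [e] but inside neither part has one vertex in each; these are the
   pairs counted by the two rank-one terms. *)
have := disj (enum_val i); have := disj (enum_val j).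
by do 4!case: (_ \in _) => //=; move=> _ _; ring.
Qed.
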